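(* Let $[a,b]$ be a compact line (with least element $a$ and greatest element $b$) and let $G:[a,b]\to \mathbb{R}$ be an amenable function. For every $c\in [a,b]$, a function $f:[a,b]\to\mathbb R$ is $G$-integrable on $[a,b]$ if and only if it is $G$-integrable on both $[a,c]$ and $[c,b]$. In that case, \[\int_a^b f\,dG = \int_a^c f\,dG + \int_c^b f\,dG - f(c)G(c).\]
   Context: A compact line is a nonempty linearly ordered set $K$ whose order topology is compact; $0_K$ and $1_K$ denote its least and greatest elements (they exist), and intervals are written as usual, e.g. $(x,y]=\{z\in K: x<z\le y\}$. An open interval of $K$ is an interval that is an open subset of $K$. Integral. A partition of $K$ is $P=\{([x_{i-1},x_i],t_i):1\le i\le n\}$ with $0_K=x_0\le x_1\le\dots\le x_n=1_K$ in $K$ and $t_i\in[x_{i-1},x_i]$. A gauge on $K$ is a function $\delta$ assigning to each $x\in K$ an open interval $\delta(x)$ of $K$ with $x\in\delta(x)$. $P$ is $\delta$-fine, written $P\ll\delta$, if $(x_{i-1},x_i]\subset\delta(t_i)$ for all $i$. For $f,G:K\to\mathbb R$ set $S(f,G,P)=f(0_K)G(0_K)+\sum_{i=1}^n f(t_i)(G(x_i)-G(x_{i-1}))$. The function $f$ is $G$-integrable, with integral $\int_K f\,dG=A\in\mathbb R$, if for each $\varepsilon>0$ there is a gauge $\delta$ on $K$ such that $|S(f,G,P)-A|<\varepsilon$ for every $P\ll\delta$. For $u\le v$ in $K$, the interval $[u,v]$ is itself a compact line (with least element $u$); $f$ is $G$-integrable on $[u,v]$ if $f|_{[u,v]}$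 is integrable over $[u,v]$ with respect to $G|_{[u,v]}$, and $\int_u^v f\,dG$ denotes that integral (so its Riemann sums contain the term $f(u)G(u)$). A point $x\in[0_K,1_K)$ is right-dense if every neighborhood of $x$ contains a point greater than $x$; $x\in(0_K,1_K]$ is left-dense if every neighborhood of $x$ contains a point less than $x$. A function $G:K\to\mathbb R$ is amenable if it is right-continuous (at each $x\in[0_K,1_K)$, for every $\varepsilon>0$ there is a neighborhood $V$ of $x$ with $|G(y)-G(x)|<\varepsilon$ for $y\in V\cap[x,1_K]$) and regulated (the left-hand limit exists in $\mathbb R$ at every left-dense point and the right-hand limit exists in $\mathbb R$ at every right-dense point). *)

(* Defs.v *)
From HB Require Import structures.
From mathcomp Require Import all_boot all_order all_algebra.
From mathcomp Require Import all_classical reals topology normedtype.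

Set Implicit Arguments.
Unset Strict Implicit.
Unset Printing Implicit Defensive.

Import Order.TTheory GRing.Theory Num.Theory.
Import numFieldTopology.Exports.

Local Open Scope classical_set_scope.
Local Open Scope ring_scope.

Section compact_line.
Context {d : Order.disp_t}.

(* A nonempty linearly ordered set with compact order topology has a least and
   a greatest element, so nothing is lost by taking [\bot] and [\top] as part of
   the structure. *)
Definition compact_line (K : tbOrderType d) : Prop :=
  compact [set: order_topology K].

Variables (R : realType) (K : tbOrderType d).

Definition right_dense (x : K) : Prop :=
  (x < \top)%O /\
  forall V : set K, nbhs (x : order_topology K) V -> exists2 y, V y & (x < y)%O.

Definition left_dense (x : K) : Prop :=
  (\bot < x)%O /\
  forall V : set K, nbhs (x : order_topology K) V -> exists2 y, V y & (y < x)%O.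

Definition right_continuous (G : K -> R) : Prop :=
  forall x : K, (x < \top)%O ->
    G y @[y --> within [set y | (x <= y)%O] (nbhs (x : order_topology K))]
      --> G x.

Definition regulated (G : K -> R) : Prop :=
  (forall x : K, left_dense x ->
    cvg (G y @[y --> within [set y | (y < x)%O]
                       (nbhs (x : order_topology K))])) /\
  (forall x : K, right_dense x ->
    cvg (G y @[y --> within [set y | (x < y)%O]
                       (nbhs (x : order_topology K))])).

Definition amenable (G : K -> R) : Prop := right_continuous G /\ regulated G.

(* [pnode P i] is x_i and [ptag P i] is t_(i+1); values outside the ranges
   0 <= i <= n, resp. 0 <= i < n, with n = [psize P], are never used. *)
Record partition : Type := Partition {
  psize : nat;
  pnode : nat -> K;
  ptag : nat -> K;
  pnode_first : pnode 0 = \bot%O;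
  pnode_last : pnode psize = \top%O;
  pnode_le : forall i, (i < psize)%N -> (pnode i <= pnode i.+1)%O;
  ptag_in : forall i, (i < psize)%N -> ptag i \in `[pnode i, pnode i.+1]%O }.

(* [interval K] includes half-open, closed and unbounded intervals; the only
   requirement is that the underlying set be open. By completeness, every
   order-convex subset of a compact line is of the form [[set` i]]. *)
Definition is_gauge (delta : K -> interval K) : Prop :=
  forall x : K, open ([set` delta x] : set (order_topology K)) /\ x \in delta x.

Definition fine (P : partition) (delta : K -> interval K) : Prop :=
  forall i, (i < psize P)%N ->
    [set` `]pnode P i, pnode P i.+1]%O] `<=` [set` delta (ptag P i)].

Definition riemann_sum (f G : K -> R) (P : partition) : R :=
  f \bot%O * G \bot%O +
  \sum_(i < psize P) f (ptag P i) * (G (pnode P i.+1) - G (pnode P i)).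

Definition has_integral (f G : K -> R) (A : R) : Prop :=
  forall e : R, 0 < e ->
    exists2 delta : K -> interval K, is_gauge delta &
      forall P : partition, fine P delta -> `|riemann_sum f G P - A| < e.

Definition G_integrable (f G : K -> R) : Prop :=
  exists A : R, has_integral f G A.

(* Meaningful only when [f] is [G]-integrable; the default value is 0. *)
Definition G_integral (f G : K -> R) : R := xget 0 [set A | has_integral f G A].

End compact_line.

(* The proof of [u <= v] is a parameter so that the canonical least and greatest
   elements of [u, v] can be inferred. *)
Definition segment {d : Order.disp_t} {K : orderType d} (u v : K)
  of (u <= v)%O : Type := {x : K | x \in `[u, v]%O}.

Section segment.
Context {d : Order.disp_t} {K : orderType d} (u v : K) (uv : (u <= v)%O).

HB.instance Definition _ := SubChoice.on (segment uv).
HB.instance Definition _ := [SubChoice_isSubOrder of segment uv by <: with d].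

Fact segment_left_in : u \in `[u, v]%O.
Proof. by rewrite in_itv /= lexx. Qed.

Fact segment_right_in : v \in `[u, v]%O.
Proof. by rewrite in_itv /= lexx andbT. Qed.

Let segment_bot : segment uv := exist _ u segment_left_in.
Let segment_top : segment uv := exist _ v segment_right_in.

Fact segment_ge_bot (x : segment uv) : (segment_bot <= x)%O.
Proof. by have := valP x; rewrite in_itv /= => /andP[]. Qed.

Fact segment_le_top (x : segment uv) : (x <= segment_top)%O.
Proof. by have := valP x; rewrite in_itv /= => /andP[]. Qed.

HB.instance Definition _ := Order.hasBottom.Build d (segment uv) segment_ge_bot.
HB.instance Definition _ := Order.hasTop.Build d (segment uv) segment_le_top.

Definition restr (T : Type) (f : K -> T) : segment uv -> T := f \o val.

End segment.
Arguments restr {d K u v} uv {T} f.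

Definition G_integrable_on {d : Order.disp_t} {R : realType} {K : orderType d}
    (u v : K) (uv : (u <= v)%O) (f G : K -> R) : Prop :=
  G_integrable (restr uv f) (restr uv G).

Definition G_integral_on {d : Order.disp_t} {R : realType} {K : orderType d}
    (u v : K) (uv : (u <= v)%O) (f G : K -> R) : R :=
  G_integral (restr uv f) (restr uv G).

(* Main.v *)
(* A point [c] can be forced to be a tag: intersect a gauge with neighborhoods
   that avoid [c] at every other point. A fine partition of [a, b] then splits
   at [c], the Riemann sums of the halves counting [f(c)G(c)] once too often, and
   this gives integrability on [a, b] from that on the halves. Conversely, fine
   partitions of the halves concatenate. Completing two of them on one half by a
   common fine partition of the other half, which exists by Cousin's lemma, shows
   that the Riemann sums on each half satisfy the Cauchy criterion.
   Everything is carried out inside [K], with arbitrary neighborhoods in place of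
   open intervals: every neighborhood contains an open interval, and each
   segment carries the topology induced by [K]. *)
Require Import Defs.
From mathcomp Require Import all_boot all_order all_algebra.
From mathcomp Require Import all_classical reals topology normedtype.
From mathcomp Require Import ring lra.

Set Implicit Arguments.
Unset Strict Implicit.
Unset Printing Implicit Defensive.

Import Order.TTheory GRing.Theory Num.Theory.
Import numFieldNormedType.Exports.

Local Open Scope classical_set_scope.
Local Open Scope ring_scope.

(** * Order intervals, rays and neighborhood gauges *)

Lemma itv_convex {d : Order.disp_t} {T : orderType d} (i : interval T) (x y z : T) :
  x \in i -> y \in i -> (x <= z <= y)%O -> z \in i.
Proof.
case: i => l r; rewrite !itv_boundlr => /andP[lx _] /andP[_ yr] /andP[xz zy].
by rewrite (le_trans lx) ?bnd_simp//= (le_trans _ yr) ?bnd_simp.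
Qed.

Section nbhd_gauge.
Context {d : Order.disp_t} {K : orderType d}.
Implicit Types (D : K -> set K) (x y z : K).

Definition nbhd_gauge D : Prop :=
  forall x, nbhs (x : order_topology K) (D x).

Lemma nbhd_gaugeI D1 D2 :
  nbhd_gauge D1 -> nbhd_gauge D2 -> nbhd_gauge (fun x => D1 x `&` D2 x).
Proof. by move=> h1 h2 x; exact: filterI. Qed.

Lemma nbhs_lray x c : (x < c)%O -> nbhs (x : order_topology K) [set` `]-oo, c[].
Proof.
move=> xc; apply: (@open_nbhs_nbhs (order_topology K)); split.
  exact: (@lray_open _ (order_topology K)).
by rewrite /= in_itv.
Qed.

Lemma nbhs_rray x c : (c < x)%O -> nbhs (x : order_topology K) [set` `]c, +oo[].
Proof.
move=> xc; apply: (@open_nbhs_nbhs (order_topology K)); split.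
  exact: (@rray_open _ (order_topology K)).
by rewrite /= in_itv /= andbT.
Qed.

(** The set is the whole line at [x = c] and the complement of [c] elsewhere. Intersecting a gauge
    with it forces any link passing over [c] to have tag [c]. *)
Lemma nbhd_gauge_neq c : nbhd_gauge (fun x => [set y | y = c -> x = c]).
Proof.
move=> x; have [->|xc] := eqVneq x c; first by apply: filterS filterT => y.
case: (ltgtP x c) xc => // xc _.
- apply: filterS (nbhs_lray xc) => y /=; rewrite in_itv /= => yc yE.
  by rewrite yE ltxx in yc.
- apply: filterS (nbhs_rray xc) => y /=; rewrite in_itv /= andbT => yc yE.
  by rewrite yE ltxx in yc.
Qed.

Lemma open_itv_nbhd_gauge (delta : K -> interval K) :
  (forall x, open ([set` delta x] : set (order_topology K)) /\ x \in delta x) ->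
  nbhd_gauge (fun x => [set` delta x]).
Proof.
by move=> h x; have [oD xD] := h x; exact: (@open_nbhs_nbhs (order_topology K)).
Qed.

Lemma nbhd_gauge_refine D : nbhd_gauge D ->
  exists2 delta : K -> interval K,
    (forall x, open ([set` delta x] : set (order_topology K)) /\ x \in delta x) &
    forall x, [set` delta x] `<=` D x.
Proof.
move=> gD.
have /choice[delta hdelta] x : exists i : interval K,
    [/\ itv_open_ends i, x \in i & [set` i] `<=` D x].
  by have := gD x; rewrite order_nbhs_itv => -[i [oi xi] iD]; exists i.
exists delta => x; have [oi xi iD] := hdelta x => //.
by split=> //; exact: (@itv_open_ends_open _ (order_topology K)).
Qed.

End nbhd_gauge.

(** Separating the constraints from the left and from the right lets each be transported between a
    segment and the whole line on its own. *)
Lemma nbhs_raysP {d : Order.disp_t} {T : orderType d} (x : T) (V : set T) :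
  nbhs (x : order_topology T) V -> exists A B : set T,
    [/\ A = setT \/ (exists2 a, (a < x)%O & A = [set y | a < y]%O),
        B = setT \/ (exists2 b, (x < b)%O & B = [set y | y < b]%O) &
        A `&` B `<=` V].
Proof.
rewrite order_nbhs_itv => -[[l r] [oi xi] iV].
exists [set y | (l <= BLeft y)%O], [set y | (BRight y <= r)%O]; split.
- case: l oi xi {iV} => [b a|b] oi; rewrite itv_boundlr => /andP[+ _]; last first.
    by rewrite (itv_open_ends_linfty oi) => _; left; apply/seteqP; split.
  rewrite (itv_open_ends_lside oi) bnd_simp => ax; right; exists a; first exact: ax.
  by apply/seteqP; split=> y /=; rewrite bnd_simp.
- case: r oi xi {iV} => [b a|b] oi; rewrite itv_boundlr => /andP[_ +]; last first.
    by rewrite (itv_open_ends_rinfty oi) => _; left; apply/seteqP; split=> // -[].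
  rewrite (itv_open_ends_rside oi) bnd_simp => xa; right; exists a; first exact: xa.
  by apply/seteqP; split=> y /=; rewrite bnd_simp.
- by move=> y [/= ly yr]; apply: iV; rewrite /= itv_boundlr ly.
Qed.

(** * Fine chains and their Riemann sums *)

Section chain.
Context {R : realType} {d : Order.disp_t} {K : orderType d}.
Implicit Types (D : K -> set K) (f G : K -> R) (x y z c : K).

(* [chain D f G u v s]: some [D]-fine tagged subdivision of [u, v] has increments
   summing to [s]. The initial term [f u * G u] is left out, which makes [s]
   additive. *)
Inductive chain D f G : K -> K -> R -> Prop :=
| chain_nil x : chain D f G x x 0
| chain_cons x t y z s : (x <= t <= y)%O ->
    (forall w, (x < w <= y)%O -> D t w) -> chain D f G y z s ->
    chain D f G x z (f t * (G y - G x) + s).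

Lemma chain_le D f G x z s : chain D f G x z s -> (x <= z)%O.
Proof.
elim=> // {}x t y {}z {}s /andP[xt ty] _ _ yz.
exact: le_trans xt (le_trans ty yz).
Qed.

Lemma chain_sub D D' f G x z s : (forall t, D t `<=` D' t) ->
  chain D f G x z s -> chain D' f G x z s.
Proof.
move=> DD'; elim=> [{}x|{}x t y {}z {}s xty Dt _ IH]; first exact: chain_nil.
by apply: chain_cons xty _ IH => w /Dt/DD'.
Qed.

Lemma chain_cat D f G x y z s1 s2 :
  chain D f G x y s1 -> chain D f G y z s2 -> chain D f G x z (s1 + s2).
Proof.
elim=> [{}x|{}x t {}y w {}s1 xty Dt _ IH] C2; first by rewrite add0r.
by rewrite -addrA; apply: chain_cons xty Dt _; exact: IH.
Qed.

Lemma chain1 D f G x t y : (x <= t <= y)%O ->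
  (forall w, (x < w <= y)%O -> D t w) ->
  chain D f G x y (f t * (G y - G x)).
Proof.
move=> xty Dt; rewrite -[X in chain _ _ _ _ _ X]addr0.
by apply: chain_cons xty Dt _; exact: chain_nil.
Qed.

(* Only the tag [c] may cover the point [c], so the link of the chain passing
   over [c] is cut into two links with the same tag. *)
Lemma chain_split D f G u c v s : (forall x, D x c -> x = c) ->
  chain D f G u v s -> (u <= c <= v)%O ->
  exists s1 s2, [/\ chain D f G u c s1, chain D f G c v s2 & s = s1 + s2].
Proof.
move=> Dc; elim=> [x|x t y z {}s xty Dt C IH] /andP[xc cz].
  have <- : x = c by apply/eqP; rewrite eq_le xc.
  by exists 0, 0; split; rewrite ?addr0//; exact: chain_nil.
have [cx|ltxc] := leP c x.
  have <- : x = c by apply/eqP; rewrite eq_le xc.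
  exists 0, (f t * (G y - G x) + s); split; rewrite ?add0r//.
    exact: chain_nil.
  exact: chain_cons xty Dt C.
have [cy|/ltW yc] := leP c y; last first.
  have [|s1 [s2 [C1 C2 ->]]] := IH; first by rewrite yc.
  exists (f t * (G y - G x) + s1), s2; split; rewrite ?addrA//.
  exact: chain_cons xty Dt C1.
have tc : t = c by apply/Dc/Dt; rewrite ltxc.
subst t; exists (f c * (G c - G x)), (f c * (G y - G c) + s); split.
- apply: chain1; first by rewrite xc /=.
  by move=> w /andP[xw wc]; apply: Dt; rewrite xw (le_trans wc).
- apply: chain_cons C; first by rewrite lexx.
  by move=> w /andP[cw wy]; apply: Dt; rewrite wy (le_lt_trans xc cw).
- by rewrite addrA -mulrDr; congr (_ * _ + _); ring.
Qed.

(** * Suprema, infima and Cousin's lemma from compactness *)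

Lemma compact_line_cofinal_cluster (A : set K) (r : rel K) :
  compact [set: order_topology K] -> A !=set0 -> transitive r -> total r ->
  exists p, forall y V, A y -> nbhs (p : order_topology K) V ->
    exists z, [/\ A z, r y z & V z].
Proof.
move=> cK [a Aa] rtr rto.
(* The tails of [A] in the direction [r] form a filter base; near a cluster point there are members
   of [A] arbitrarily far along. The orders [<=] and [>=] then yield supremum and infimum. *)
pose F : set_system (order_topology K) :=
  filter_from A (fun y => [set z | A z /\ r y z]).
have PF : ProperFilter F.
  apply: filter_from_proper; last first.
    by move=> y Ay; exists y; split=> //; have := rto y y; rewrite orbb.
  apply: filter_from_filter; first by exists a.
  move=> x y Ax Ay; have /orP[xy|yx] := rto x y.
  - exists y => // z [Az yz]; split; split=> //; exact: rtr yz.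
  - exists x => // z [Az xz]; split; split=> //; exact: rtr xz.
have [|p [_ Fp]] := cK F PF; first exact: filterT.
exists p => y V Ay pV.
have [|z [[Az yz] Vz]] := Fp [set z | A z /\ r y z] V _ pV; first by exists y.
by exists z.
Qed.

Lemma compact_line_sup (A : set K) :
  compact [set: order_topology K] -> A !=set0 ->
  exists2 p, ubound A p & forall V, nbhs (p : order_topology K) V ->
    A `&` V !=set0.
Proof.
move=> cK A0.
have [//||p Hp] := compact_line_cofinal_cluster (r := <=%O) cK A0.
- exact: le_trans.
- exact: le_total.
exists p => [y Ay|V pV].
- rewrite leNgt; apply/negP => py.
  have [z [_ yz]] := Hp y _ Ay (nbhs_lray py).
  by rewrite /= in_itv /= ltNge yz.
- by have [a Aa] := A0; have [z [Az _ Vz]] := Hp a V Aa pV; exists z.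
Qed.

Lemma compact_line_inf (A : set K) :
  compact [set: order_topology K] -> A !=set0 ->
  exists2 p, lbound A p & forall V, nbhs (p : order_topology K) V ->
    A `&` V !=set0.
Proof.
move=> cK A0.
have [//||p Hp] := compact_line_cofinal_cluster (r := >=%O) cK A0.
- exact: ge_trans.
- exact: ge_total.
exists p => [y Ay|V pV].
- rewrite leNgt; apply/negP => py.
  have [z [_ yz]] := Hp y _ Ay (nbhs_rray py).
  by rewrite /= in_itv /= andbT ltNge (yz : (z <= y)%O).
- by have [a Aa] := A0; have [z [Az _ Vz]] := Hp a V Aa pV; exists z.
Qed.

(** Let [p] be the supremum of the points up to [v] that chains from [u] reach. It is itself
    reached, and if it were below [v] one more link would lead past it. *)
Lemma cousin D f G u v : compact [set: order_topology K] -> nbhd_gauge D ->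
  (u <= v)%O -> exists s, chain D f G u v s.
Proof.
move=> cK /nbhd_gauge_refine[delta gd dD] uv.
suff [s C] : exists s, chain (fun x => [set` delta x]) f G u v s.
  by exists s; exact: chain_sub dD C.
have nd x := open_itv_nbhd_gauge gd x; have xd x : x \in delta x by case: (gd x).
have dcvx t x y w : x \in delta t -> y \in delta t -> (x < w <= y)%O ->
    w \in delta t.
  by move=> xt yt /andP[/ltW xw wy]; apply: (itv_convex xt yt); rewrite xw.
pose A := [set x | (x <= v)%O /\
  exists s, chain (fun x => [set` delta x]) f G u x s].
have [|p Ap pA] := compact_line_sup (A := A) cK.
  by exists u; split=> //; exists 0; exact: chain_nil.
have [z [[zv [s C]] zp]] := pA _ (nd p).
have zp' : (z <= p)%O by apply: Ap; split=> //; exists s.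
have pv : (p <= v)%O.
  rewrite leNgt; apply/negP => /nbhs_rray/pA[y [[yv _]]].
  by rewrite /= in_itv /= andbT ltNge yv.
have {z zv s C zp zp'} [s C] : exists s, chain (fun x => [set` delta x]) f G u p s.
  (* The reached point [z] lies in the convex set [delta p], so a last link from [z] to [p] can be
     tagged [p]. *)
  exists (s + f p * (G p - G z)); apply: chain_cat C _; apply: chain1.
    by rewrite zp' lexx.
  by move=> w; exact: dcvx.
have [vp|ltpv] := leP v p.
  by exists s; have <- : p = v by apply/eqP; rewrite eq_le pv.
pose B := [set y | (p < y <= v)%O].
have [|q Bq qB] := compact_line_inf (A := B) cK; first by exists v; rewrite /B/= ltpv /=.
(* Any admissible link from [p] to a later point contradicts the choice of [p] as supremum. *)
have ext y t : (p < y <= v)%O -> (p <= t <= y)%O ->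
    (forall w, (p < w <= y)%O -> w \in delta t) -> False.
  move=> /andP[py yv] pty Dt.
  have /Ap : A y.
    split=> //; exists (s + f t * (G y - G p)); apply: chain_cat C _.
    exact: chain1.
  by rewrite leNgt py.
(* If [q] is not [p], then it is the successor of [p] and [(p, q] = {q}]. *)
exfalso; have [pq|qp] := ltP p q.
  have qv : (q <= v)%O by apply: Bq; rewrite /B/= ltpv lexx.
  apply: (ext q q); rewrite ?pq ?qv ?lexx ?andbT ?(ltW pq)// => w /andP[pw wq].
  suff -> : w = q by exact: xd.
  by apply/eqP; rewrite eq_le wq Bq// /B/= pw (le_trans wq).
have {qp} qp : q = p.
  apply/eqP; rewrite eq_le qp /= leNgt; apply/negP => /nbhs_lray/qB[y [/andP[py _]]].
  by rewrite /= in_itv /= ltNge (ltW py).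
(* Now points of [B] accumulate at [p] from the right, so [delta p] contains some [y] beyond [p] and
   the link to it can be tagged [p]. *)
have [y [/andP[py yv] yd]] := qB _ (nd q); rewrite qp in yd.
apply: (ext y p); rewrite ?py ?yv ?lexx ?(ltW py)// => w.
exact: dcvx.
Qed.

(** * Integrals over subintervals, with gauges on the whole line *)

(** The initial term [f u * G u], left out of [chain], is restored here. *)
Definition itv_integral f G u v (A : R) : Prop :=
  forall e : R, 0 < e -> exists2 D, nbhd_gauge D &
    forall s, chain D f G u v s -> `|f u * G u + s - A| < e.

(** By Cousin's lemma some chain is fine for both gauges at once, and its sum is close to both
    values. *)
Lemma itv_integral_unique f G u v A B : compact [set: order_topology K] ->
  (u <= v)%O -> itv_integral f G u v A -> itv_integral f G u v B -> A = B.
Proof.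
move=> cK uv hA hB; apply/eqP; rewrite -subr_eq0 -normr_le0.
apply/ler_addgt0Pl => e e0; rewrite addr0.
have e2 : 0 < e / 2 by rewrite divr_gt0.
have [D1 g1 h1] := hA _ e2; have [D2 g2 h2] := hB _ e2.
have [s C] := cousin f G cK (nbhd_gaugeI g1 g2) uv.
have /h1 : chain D1 f G u v s by apply: chain_sub C => t w [].
have /h2 : chain D2 f G u v s by apply: chain_sub C => t w [].
by rewrite !ltr_norml => /andP[? ?] /andP[? ?]; rewrite ler_norml; lra.
Qed.

(** The sets of sums over [D]-fine chains form a filter base: nonempty by Cousin's lemma, directed
    by intersecting gauges. The hypothesis makes the filter Cauchy, and completeness of the reals
    gives the limit. *)
Lemma itv_integral_cauchy f G u v : compact [set: order_topology K] ->
  (u <= v)%O ->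
  (forall e : R, 0 < e -> exists2 D, nbhd_gauge D &
    forall s s', chain D f G u v s -> chain D f G u v s' -> `|s - s'| < e) ->
  exists A, itv_integral f G u v A.
Proof.
move=> cK uv H.
pose F : set_system R := filter_from nbhd_gauge
  (fun D => [set r | exists2 s, chain D f G u v s & r = f u * G u + s]).
have PF : ProperFilter F.
  apply: filter_from_proper; last first.
    by move=> D gD; have [s C] := cousin f G cK gD uv; exists (f u * G u + s), s.
  apply: filter_from_filter; first by exists (fun=> setT) => x; exact: filterT.
  move=> D1 D2 g1 g2; exists (fun x => D1 x `&` D2 x); first exact: nbhd_gaugeI.
  by move=> _ [s C ->]; split; exists s => //; apply: chain_sub C => t w [].
have cF : cauchy F.
  apply/cauchy_ballP => e e0; have [D gD HD] := H e e0.
  pose V := [set r | exists2 s, chain D f G u v s & r = f u * G u + s].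
  exists (V, V); first by split; exists D.
  move=> [_ _] /= [[s C ->] [s' C' ->]].
  rewrite /ball /= opprD addrACA subrr add0r; exact: HD.
have /cauchy_cvgP := cF; move=> /cvg_ex[A FA].
exists A => e e0; have /FA : nbhs A (ball A e) by exact: nbhsx_ballx.
move=> [D gD HD]; exists D => // s C; rewrite distrC.
by apply: HD; exists s.
Qed.

Lemma itv_integral_cat f G u c v A B : (u <= c <= v)%O ->
  itv_integral f G u c A -> itv_integral f G c v B ->
  itv_integral f G u v (A + B - f c * G c).
Proof.
move=> ucv hA hB e e0; have e2 : 0 < e / 2 by rewrite divr_gt0.
have [D1 g1 h1] := hA _ e2; have [D2 g2 h2] := hB _ e2.
pose D x := (D1 x `&` D2 x) `&` [set y | y = c -> x = c].
exists D => [|s C].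
  by apply: nbhd_gaugeI; [exact: nbhd_gaugeI|exact: nbhd_gauge_neq].
have [|s1 [s2 [C1 C2 ->]]] := chain_split _ C ucv.
  by move=> x [_ /(_ erefl)].
have /h1 : chain D1 f G u c s1 by apply: chain_sub C1 => t w [[]].
have /h2 : chain D2 f G c v s2 by apply: chain_sub C2 => t w [[]].
(* The sum on the right half carries its own initial term [f c * G c], which is absent from the sum
   on [[u, v]]; hence the correction. *)
by rewrite !ltr_norml => /andP[? ?] /andP[? ?]; lra.
Qed.

Lemma itv_integrable_sub f G u c v A : compact [set: order_topology K] ->
  (u <= c <= v)%O -> itv_integral f G u v A ->
  (exists A1, itv_integral f G u c A1) /\ (exists A2, itv_integral f G c v A2).
Proof.
move=> cK /andP[uc cv] hA; split; apply: itv_integral_cauchy => // e e0.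
- have [D gD HD] := hA (e / 2) (divr_gt0 e0 (ltr0n _ 2)).
  (* The same [s2] completes both chains and cancels in [s - s']; each completed sum is within
     [e / 2] of [A]. *)
  exists D => // s s' C C'; have [s2 C2] := cousin f G cK gD cv.
  have := HD _ (chain_cat C C2).
  have := HD _ (chain_cat C' C2).
  by rewrite !ltr_norml => /andP[? ?] /andP[? ?]; lra.
- have [D gD HD] := hA (e / 2) (divr_gt0 e0 (ltr0n _ 2)).
  exists D => // s s' C C'; have [s1 C1] := cousin f G cK gD uc.
  have := HD _ (chain_cat C1 C).
  have := HD _ (chain_cat C1 C').
  by rewrite !ltr_norml => /andP[? ?] /andP[? ?]; lra.
Qed.

End chain.

(** * Chains from bottom to top versus partitions *)

Section chain_partition.
Context {R : realType} {d : Order.disp_t} {K : tbOrderType d}.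
Implicit Types (D : K -> set K) (f G : K -> R).

Lemma partition_chain (P : Defs.partition K) D f G :
  (forall i, (i < psize P)%N -> forall w, (pnode P i < w <= pnode P i.+1)%O ->
    D (ptag P i) w) ->
  chain D f G \bot%O \top%O
    (\sum_(i < psize P) f (ptag P i) * (G (pnode P i.+1) - G (pnode P i))).
Proof.
move=> PD; rewrite -(pnode_first P) -(pnode_last P).
suff H n : (n <= psize P)%N -> chain D f G (pnode P 0) (pnode P n)
    (\sum_(i < n) f (ptag P i) * (G (pnode P i.+1) - G (pnode P i))) by exact: H.
elim: n => [_|n IH nP].
  by rewrite big_ord0; exact: chain_nil.
rewrite big_ord_recr /=; apply: chain_cat (IH (ltnW nP)) _.
by apply: chain1; [have := ptag_in nP; rewrite in_itv|exact: PD].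
Qed.

Lemma chain_nodes D f G x z s : chain D f G x z s ->
  exists n (node tag : nat -> K), [/\ node 0 = x, node n = z,
    forall i, (i < n)%N -> (node i <= tag i <= node i.+1)%O,
    forall i, (i < n)%N -> forall w, (node i < w <= node i.+1)%O -> D (tag i) w &
    s = \sum_(i < n) f (tag i) * (G (node i.+1) - G (node i))].
Proof.
elim=> [{}x|{}x t y {}z {}s xty Dt _ [n [node [tag [n0 nn nt nD ->]]]]].
  by exists 0%N, (fun=> x), (fun=> x); split; rewrite ?big_ord0.
(* The new link is prepended, shifting the old indices by one; [n0] makes its right end the old
   first node. *)
exists n.+1, (fun i => if i is j.+1 then node j else x),
  (fun i => if i is j.+1 then tag j else t); split=> //=.
- by case=> [_|i]; [rewrite n0|exact: nt].
- by case=> [_|i]; [rewrite n0|exact: nD].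
- by rewrite big_ord_recl /= n0.
Qed.

Lemma chain_partitionP D f G s : chain D f G \bot%O \top%O s ->
  exists2 P : Defs.partition K,
    forall i, (i < psize P)%N -> forall w, (pnode P i < w <= pnode P i.+1)%O ->
      D (ptag P i) w &
    f \bot%O * G \bot%O + s = riemann_sum f G P.
Proof.
move=> /chain_nodes[n [node [tag [n0 nn nt nD ->]]]].
have nle i : (i < n)%N -> (node i <= node i.+1)%O.
  by move=> /nt/andP[]; exact: le_trans.
have tin i : (i < n)%N -> tag i \in `[node i, node i.+1]%O.
  by move=> /nt; rewrite in_itv.
by exists (Partition n0 nn nle tin).
Qed.

(** Partitions and chains have the same sums. Open intervals are neighborhoods, and conversely every
    neighborhood gauge is refined by one of open intervals. *)
Lemma has_integralE f G A :
  has_integral f G A <-> itv_integral f G \bot%O \top%O A.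
Proof.
split=> h e e0; have [D gD hD] := h e e0.
- exists (fun x => [set` D x]); first exact: open_itv_nbhd_gauge.
  move=> s /chain_partitionP[P PD ->]; apply: hD => i iP w.
  by rewrite /= in_itv; exact: PD.
- have [delta gd dD] := nbhd_gauge_refine gD.
  exists delta => // P Pd; apply: hD; apply: partition_chain => i iP w xwy.
  by apply/dD/(Pd i iP); rewrite /= in_itv.
Qed.

End chain_partition.

(** * Segments and their induced topology *)

Section segment_integral.
Context {R : realType} {d : Order.disp_t} {K : orderType d}.
Context {u v : K} (uv : (u <= v)%O).
Implicit Types (f G : K -> R).
Local Notation S := (segment uv).

Let seg (x : K) (h : x \in `[u, v]%O) : S := exist _ x h.

(** A ray around [val x] with endpoint in [[u, v]] restricts to a ray of the segment; with endpoint
    outside, it contains the whole segment. *)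
Lemma nbhs_segment_val (x : S) (U : set K) :
  nbhs (val x : order_topology K) U ->
  nbhs (x : order_topology S) [set y | U (val y)].
Proof.
have segP (y : S) : (u <= val y <= v)%O by have := valP y; rewrite in_itv.
move=> /nbhs_raysP[A [B [hA hB ABU]]].
suff [nA nB] : nbhs (x : order_topology S) [set y | A (val y)] /\
    nbhs (x : order_topology S) [set y | B (val y)].
  by apply: filterS (filterI nA nB) => y [Ay By]; exact: ABU.
split.
- case: hA => [->|[a ax ->]]; first by apply: filterS filterT.
  have [ua|au] := leP u a; last first.
    by apply: filterS filterT => y _ /=; have /andP[+ _] := segP y; exact: lt_le_trans.
  have ha : a \in `[u, v]%O.
    by have /andP[_ xv] := segP x; rewrite in_itv /= ua (le_trans (ltW ax)).
  by apply: filterS (@nbhs_rray _ _ x (seg ha) ax) => y; rewrite /= in_itv /= andbT.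
- case: hB => [->|[b xb ->]]; first by apply: filterS filterT.
  have [bv|vb] := leP b v; last first.
    by apply: filterS filterT => y _ /=; have /andP[_ yv] := segP y; exact: le_lt_trans yv vb.
  have hb : b \in `[u, v]%O.
    by have /andP[ux _] := segP x; rewrite in_itv /= bv (le_trans ux (ltW xb)).
  by apply: filterS (@nbhs_lray _ _ x (seg hb) xb) => y; rewrite /= in_itv.
Qed.

(** A ray of the segment is the trace of the ray of [K] with the same endpoint; points outside
    [[u, v]] qualify vacuously. *)
Lemma nbhs_segment_ext (x : S) (V : set S) :
  nbhs (x : order_topology S) V ->
  nbhs (val x : order_topology K) [set y | forall h : y \in `[u, v]%O, V (seg h)].
Proof.
move=> /nbhs_raysP[A [B [hA hB ABV]]].
suff [nA nB] : nbhs (val x : order_topology K) [set y | forall h : y \in `[u, v]%O, A (seg h)] /\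
    nbhs (val x : order_topology K) [set y | forall h : y \in `[u, v]%O, B (seg h)].
  by apply: filterS (filterI nA nB) => y [Ay By] h; apply: ABV.
split.
- case: hA => [->|[a ax ->]]; first by apply: filterS filterT.
  by apply: filterS (@nbhs_rray _ _ (val x) (val a) ax) => y; rewrite /= in_itv /= andbT.
- case: hB => [->|[b xb ->]]; first by apply: filterS filterT.
  by apply: filterS (@nbhs_lray _ _ (val x) (val b) xb) => y; rewrite /= in_itv.
Qed.

Lemma segment_chain (D : S -> set S) (E : K -> set K) f G (x z : S) s :
  (forall t w : S, D t w -> E (val t) (val w)) ->
  chain D (restr uv f) (restr uv G) x z s -> chain E f G (val x) (val z) s.
Proof.
move=> DE; elim=> [{}x|{}x t y {}z {}s xty Dt _ IH]; first exact: chain_nil.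
apply: (@chain_cons _ _ _ _ _ _ (val x) (val t) (val y)) IH => // w /andP[xw wy].
have h : w \in `[u, v]%O.
  have := valP x; have := valP y; rewrite !in_itv /= => /andP[_ yv] /andP[ux _].
  by rewrite (le_trans ux (ltW xw)) (le_trans wy yv).
by apply: (DE t (seg h)); apply: Dt; apply/andP; split.
Qed.

(** Nodes and tags lie between the ends of the chain, so they all belong to the segment. *)
Lemma chain_segment (D : S -> set S) (E : K -> set K) f G x z s :
  (forall t w : S, E (val t) (val w) -> D t w) ->
  chain E f G x z s -> forall (hx : x \in `[u, v]%O) (hz : z \in `[u, v]%O),
  chain D (restr uv f) (restr uv G) (seg hx) (seg hz) s.
Proof.
move=> ED; elim=> [{}x|{}x t y {}z {}s xty Et C IH] hx hz.
  by rewrite (bool_irrelevance hx hz); exact: chain_nil.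
have /andP[xt ty] := xty; have yz := chain_le C.
have ht : t \in `[u, v]%O.
  move: hx hz; rewrite !in_itv /= => /andP[ux _] /andP[_ zv].
  by rewrite (le_trans ux xt) (le_trans ty (le_trans yz zv)).
have hy : y \in `[u, v]%O.
  move: ht hz; rewrite !in_itv /= => /andP[ut _] /andP[_ zv].
  by rewrite (le_trans ut ty) (le_trans yz zv).
apply: (@chain_cons _ _ _ _ _ _ _ (seg ht) (seg hy)) => //.
by move=> w /andP[xw wy]; apply: ED; apply: Et; apply/andP; split.
Qed.

Lemma has_integral_segmentE f G A :
  has_integral (restr uv f) (restr uv G) A <-> itv_integral f G u v A.
Proof.
rewrite has_integralE; split=> h e e0; have [D gD hD] := h e e0.
(* Outside [[u, v]] this gauge is all of [K]; the tags of a chain from [u] to [v] never lie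
   there. *)
- exists (fun x => [set y | forall (hx : x \in `[u, v]%O) (hy : y \in `[u, v]%O), D (seg hx) (seg hy)]).
    move=> x; have [hx|nhx] := pselect (x \in `[u, v]%O).
      apply: filterS (nbhs_segment_ext (gD (seg hx))) => y /= Dy hx' hy.
      by rewrite (bool_irrelevance hx' hx).
    by apply: filterS filterT => y _ hx; case: (nhx hx).
  move=> s C; apply: (hD s).
  apply: (chain_segment _ C) => t w /= /(_ (valP t) (valP w)).
  by case: t => ? ?; case: w => ? ?; congr D; apply: val_inj.
- exists (fun x : S => [set y : S | D (val x) (val y)]).
    by move=> x; exact: nbhs_segment_val.
  by move=> s C; apply: (hD s); apply: segment_chain C.
Qed.

End segment_integral.

(** * Additivity of the integral at [c] *)

Lemma G_integralE (R : realType) (d : Order.disp_t) (K : tbOrderType d)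
    (f G : K -> R) (A : R) :
  (forall B, has_integral f G B -> B = A) -> has_integral f G A ->
  G_integral f G = A.
Proof. by move=> uA hA; apply: xget_unique. Qed.

Unset Implicit Arguments.

Theorem theorem3p16 (R : realType) (d : Order.disp_t) (K : tbOrderType d)
    (K_compact : compact_line K) (G : K -> R) (G_amenable : amenable G)
    (c : K) (f : K -> R) :
  (G_integrable f G <->
     G_integrable_on (le0x c) f G /\ G_integrable_on (lex1 c) f G) /\
  (G_integrable f G ->
     G_integral f G =
       G_integral_on (le0x c) f G + G_integral_on (lex1 c) f G - f c * G c).
Proof.
have bct : (\bot <= c <= \top)%O by rewrite le0x lex1.
split; first split.
- move=> [A /has_integralE/(itv_integrable_sub K_compact bct)[[A1 h1] [A2 h2]]].
  by split; [exists A1|exists A2]; apply/has_integral_segmentE.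
- move=> [[A1 /has_integral_segmentE h1] [A2 /has_integral_segmentE h2]].
  exists (A1 + A2 - f c * G c); apply/has_integralE.
  exact: itv_integral_cat bct h1 h2.
- move=> [A /has_integralE/(itv_integrable_sub K_compact bct)[[A1 h1] [A2 h2]]].
  (* [G_integral_on] is a chosen value, so uniqueness of the integral is what identifies it. *)
  have E u v (uv : (u <= v)%O) B : itv_integral f G u v B -> G_integral_on uv f G = B.
    move=> hB; apply: G_integralE => [B'|]; last exact/has_integral_segmentE.
    by move=> /has_integral_segmentE hB'; exact: itv_integral_unique K_compact uv hB' hB.
  rewrite (E _ _ _ _ h1) (E _ _ _ _ h2).
  have h := itv_integral_cat bct h1 h2.
  apply: G_integralE => [B|]; last exact/has_integralE.
  by move=> /has_integralE hB; exact: itv_integral_unique K_compact (le0x _) hB h.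
Qed.
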